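(* Let $\nu$ be an infinite regular cardinal with $\kappa=\nu^+=2^\nu$. Let $\mathscr{Coh}(\kappa,\nu)$ be the set of all $\nu$-coherent $C$-sequences of length $\kappa$, with the topology whose basic open sets are the sets of all elements of $\mathscr{Coh}(\kappa,\nu)$ extending a given $\nu$-coherent $C$-sequence of length less than $\kappa$, and let $\mathscr{Triv}(\kappa,\nu)\subseteq\mathscr{Coh}(\kappa,\nu)$ be the set of all trivial $\nu$-coherent $C$-sequences of length $\kappa$. Then: (i) $\mathscr{Triv}(\kappa,\nu)$ is the image of ${}^\kappa\kappa$ under a continuous injective function ${}^\kappa\kappa\to\mathscr{Coh}(\kappa,\nu)$; (ii) $\mathscr{Triv}(\kappa,\nu)$ does not have the $\kappa$-Baire property in $\mathscr{Coh}(\kappa,\nu)$.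
   Context: For an ordinal $\gamma$, a sequence $\langle C_\alpha:\alpha<\gamma\rangle$ is a $C$-sequence if for all $\alpha<\gamma$: if $\alpha$ is a limit ordinal then $C_\alpha$ is a closed unbounded subset of $\alpha$, and if $\alpha=\bar\alpha+1$ then $C_\alpha=\{\bar\alpha\}$. A $C$-sequence $\langle C_\alpha:\alpha<\gamma\rangle$ is $\nu$-coherent if $C_\alpha=C_\beta\cap\alpha$ for all $\beta<\gamma$ and all limit points $\alpha$ of $C_\beta$ with $\mathrm{cof}(\alpha)=\nu$. A $C$-sequence $\langle C_\alpha:\alpha<\gamma\rangle$ with $\gamma$ a limit ordinal is trivial if there is a closed unbounded $C\subseteq\gamma$ such that for every $\alpha<\gamma$ there is $\beta$ with $\alpha\le\beta<\gamma$ and $C\cap\alpha\subseteq C_\beta$. ${}^\kappa\kappa$ carries the topology with basic open sets $N_s=\{x : s\subseteq x\}$, $s$ a function from an ordinal below $\kappa$ to $\kappa$. A subset $A$ of a topological space $X$ has the $\kappa$-Baire property if there are an open $U\subseteq X$ and nowhere dense sets $N_\alpha\subseteq X$ ($\alpha<\kappa$) with the symmetric difference of $A$ and $U$ contained in $\bigcup_{\alpha<\kappa}N_\alpha$. *)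

(* Defs.v *)
From Stdlib Require Import Relations Wellfounded.

Set Implicit Arguments.

Record WellOrder (T : Type) (lt : T -> T -> Prop) : Prop := {
  wo_wf : well_founded lt;
  wo_trans : forall x y z, lt x y -> lt y z -> lt x z;
  wo_total : forall x y, lt x y \/ x = y \/ lt y x
}.

Definition injects (A B : Type) : Prop :=
  exists f : A -> B, forall a a', f a = f a' -> a = a'.

Definition bijects (A B : Type) : Prop :=
  exists f : A -> B, (forall a a', f a = f a' -> a = a') /\ (forall b, exists a, f a = b).

Definition iseg (T : Type) (lt : T -> T -> Prop) (x : T) : Type := { y : T | lt y x }.

Definition infinite_cardinal (N : Type) (ltN : N -> N -> Prop) : Prop :=
  WellOrder ltN /\ injects nat N /\ (forall x : N, ~ injects N (iseg ltN x)).

Definition regular (N : Type) (ltN : N -> N -> Prop) : Prop :=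
  forall S : N -> Prop, (forall x, exists y, S y /\ (x = y \/ ltN x y)) ->
    injects N { y : N | S y }.

Definition is_successor_cardinal_of (K : Type) (ltK : K -> K -> Prop) (N : Type) : Prop :=
  WellOrder ltK /\ (forall x : K, injects (iseg ltK x) N) /\ ~ injects K N.

Section Ord.
Context {N : Type} (ltN : N -> N -> Prop) {K : Type} (lt : K -> K -> Prop).

Definition le (x y : K) : Prop := lt x y \/ x = y.

Definition is_succ_of (alpha beta : K) : Prop :=
  lt beta alpha /\ forall xi, lt beta xi -> ~ lt xi alpha.

Definition is_limit (alpha : K) : Prop :=
  (exists beta, lt beta alpha) /\ ~ (exists beta, is_succ_of alpha beta).

Definition unbounded_in (C : K -> Prop) (alpha : K) : Prop :=
  forall beta, lt beta alpha -> exists xi, C xi /\ le beta xi /\ lt xi alpha.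

Definition club_in (C : K -> Prop) (alpha : K) : Prop :=
  (forall xi, C xi -> lt xi alpha) /\ unbounded_in C alpha /\
  (forall beta, lt beta alpha -> is_limit beta -> unbounded_in C beta -> C beta).

Definition club_kappa (C : K -> Prop) : Prop :=
  (forall beta, exists xi, C xi /\ le beta xi) /\
  (forall beta, is_limit beta -> unbounded_in C beta -> C beta).

Definition limit_point (C : K -> Prop) (alpha : K) : Prop :=
  is_limit alpha /\ unbounded_in C alpha.

Definition cofinal_map (I : Type) (ltI : I -> I -> Prop) (f : I -> K) (alpha : K) : Prop :=
  (forall i j, ltI i j -> lt (f i) (f j)) /\ (forall i, lt (f i) alpha) /\
  (forall beta, lt beta alpha -> exists i, le beta (f i)).

Definition cof_is_nu (alpha : K) : Prop :=
  (exists f : N -> K, cofinal_map ltN f alpha) /\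
  (forall x : N, ~ exists g : iseg ltN x -> K,
        cofinal_map (fun i j => ltN (proj1_sig i) (proj1_sig j)) g alpha).

(* A (possibly partial) sequence: C alpha is the set C_alpha; dom is the
   (downward closed) set of indices, i.e. the length. *)
Definition Cseq (dom : K -> Prop) (C : K -> K -> Prop) : Prop :=
  forall alpha, dom alpha ->
    (forall xi, C alpha xi -> lt xi alpha) /\
    (is_limit alpha -> club_in (C alpha) alpha) /\
    (forall beta, is_succ_of alpha beta -> forall xi, C alpha xi <-> xi = beta).

Definition nu_coherent (dom : K -> Prop) (C : K -> K -> Prop) : Prop :=
  forall beta alpha, dom beta -> lt alpha beta -> limit_point (C beta) alpha ->
    cof_is_nu alpha -> forall xi, C alpha xi <-> (C beta xi /\ lt xi alpha).

Definition Coh (C : K -> K -> Prop) : Prop :=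
  Cseq (fun _ => True) C /\ nu_coherent (fun _ => True) C.

Definition Coh_lt (gamma : K) (D : K -> K -> Prop) : Prop :=
  Cseq (fun a => lt a gamma) D /\ nu_coherent (fun a => lt a gamma) D.

Definition trivial_seq (C : K -> K -> Prop) : Prop :=
  exists C0 : K -> Prop, club_kappa C0 /\
    forall alpha, exists beta, le alpha beta /\
      forall xi, C0 xi -> lt xi alpha -> C beta xi.

Definition Triv (C : K -> K -> Prop) : Prop := Coh C /\ trivial_seq C.

Definition basic_Coh (b : (K -> K -> Prop) -> Prop) : Prop :=
  exists gamma D, Coh_lt gamma D /\
    forall C, b C <-> (Coh C /\ forall alpha, lt alpha gamma -> C alpha = D alpha).

Definition basic_Baire (b : (K -> K) -> Prop) : Prop :=
  exists (gamma : K) (s : K -> K),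
    forall x, b x <-> (forall alpha, lt alpha gamma -> x alpha = s alpha).

End Ord.

Section Topo.
Context {T : Type} (X : T -> Prop) (Bas : (T -> Prop) -> Prop).

Definition is_open (U : T -> Prop) : Prop :=
  (forall x, U x -> X x) /\
  forall x, U x -> exists b, Bas b /\ b x /\ forall y, X y -> b y -> U y.

Definition closure (A : T -> Prop) (x : T) : Prop :=
  X x /\ forall b, Bas b -> b x -> exists y, X y /\ A y /\ b y.

Definition interior (A : T -> Prop) (x : T) : Prop :=
  X x /\ exists b, Bas b /\ b x /\ forall y, X y -> b y -> A y.

Definition nowhere_dense (A : T -> Prop) : Prop :=
  (forall x, A x -> X x) /\ forall x, ~ interior (closure A) x.

Definition has_Baire_prop (I : Type) (A : T -> Prop) : Prop :=
  exists (U : T -> Prop) (Nd : I -> T -> Prop),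
    is_open U /\ (forall i, nowhere_dense (Nd i)) /\
    forall x, ((A x /\ ~ U x) \/ (U x /\ ~ A x)) -> exists i, Nd i x.
End Topo.

Definition continuous_between {T1 T2 : Type}
  (X1 : T1 -> Prop) (B1 : (T1 -> Prop) -> Prop)
  (X2 : T2 -> Prop) (B2 : (T2 -> Prop) -> Prop) (f : T1 -> T2) : Prop :=
  (forall x, X1 x -> X2 (f x)) /\
  forall U, is_open X2 B2 U -> is_open X1 B1 (fun x => X1 x /\ U (f x)).

(* Main.v *)
(** A trivial sequence [C] has a unique thread: a club [D] with [C_gamma = D ∩ gamma] at all limit points
    [gamma] of [D] of cofinality [nu].  A pair [(D, C)] is built in [kappa] stages: at stage [xi] one
    chooses the [xi]-th successor point of [D] together with the values of [C] below it, the only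
    constraint being [C_gamma = D ∩ gamma] when [gamma] is the limit of the points chosen so far and has
    cofinality [nu].  Since [2^nu = kappa], there are exactly [kappa] choices at every stage, so the
    runs of this process are parametrized by functions [kappa -> kappa]; this gives (i).

    For (ii), a run may also avoid [kappa] many nowhere dense sets, one per stage, so trivial sequences
    meet every comeager set.  Using instead at every such limit [gamma] a club of [gamma] without
    limit points of cofinality [nu], the same process yields generic nontrivial sequences inside any
    given nonempty open set. *)

From Stdlib Require Import Wellfounded ClassicalEpsilon FunctionalExtensionality PropExtensionality.
Require Import Defs.

(** * Well-orders and transfinite recursion *)

Section WellOrders.
Context {T : Type} {lt : T -> T -> Prop} (wo : WellOrder lt).

Lemma lt_irrefl x : ~ lt x x.
Proof.
  induction x as [x IH] using (well_founded_ind (wo_wf wo)).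
  intro H; exact (IH x H H).
Qed.

Lemma eq_le x y : x = y -> le lt x y.
Proof. right; assumption. Qed.

Lemma le_lt_trans x y z : le lt x y -> lt y z -> lt x z.
Proof. intros [H | ->]; [intro; exact (wo_trans wo _ _ _ H H0) | trivial]. Qed.

Lemma lt_le_trans x y z : lt x y -> le lt y z -> lt x z.
Proof. intros H [H0 | <-]; [exact (wo_trans wo _ _ _ H H0) | trivial]. Qed.

Lemma le_trans x y z : le lt x y -> le lt y z -> le lt x z.
Proof. intros H [H0 | <-]; [left; exact (le_lt_trans _ _ _ H H0) | trivial]. Qed.

Lemma le_or_lt x y : le lt x y \/ lt y x.
Proof.
  destruct (wo_total wo x y) as [H | [H | H]].
  - left; left; exact H.
  - left; right; exact H.
  - right; exact H.
Qed.

Lemma least (P : T -> Prop) :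
  (exists x, P x) -> exists x, P x /\ forall y, P y -> le lt x y.
Proof.
  intros [x Hx]; induction x as [x IH] using (well_founded_ind (wo_wf wo)).
  destruct (classic (exists y, lt y x /\ P y)) as [[y [Hy Py]] | Hn].
  - exact (IH y Hy Py).
  - exists x; split; [exact Hx |].
    intros y Py; destruct (le_or_lt x y) as [H | H]; [exact H |].
    exfalso; apply Hn; exists y; split; assumption.
Qed.

Context {A : Type} (a0 : A).

Definition restrict (xi : T) (h : T -> A) : T -> A :=
  fun eta => if excluded_middle_informative (lt eta xi) then h eta else a0.

Lemma restrict_lt xi h eta : lt eta xi -> restrict xi h eta = h eta.
Proof.
  intro H; unfold restrict.
  destruct (excluded_middle_informative (lt eta xi)); [reflexivity | contradiction].
Qed.

Lemma restrict_ext xi h h' :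
  (forall eta, lt eta xi -> h eta = h' eta) -> restrict xi h = restrict xi h'.
Proof.
  intro H; apply functional_extensionality; intro eta; unfold restrict.
  destruct (excluded_middle_informative (lt eta xi)); [apply H; assumption | reflexivity].
Qed.

Lemma transfinite_recursion (step : T -> (T -> A) -> A) :
  exists Y, forall xi, Y xi = step xi (restrict xi Y).
Proof.
  pose (F := fun xi (rec : forall eta, lt eta xi -> A) =>
    step xi (fun eta => match excluded_middle_informative (lt eta xi) with
                        | left p => rec eta p
                        | right _ => a0
                        end)).
  exists (Fix (wo_wf wo) (fun _ => A) F); intro xi.
  rewrite Fix_eq; [reflexivity |].
  intros x f g E; unfold F; f_equal; apply functional_extensionality; intro eta.
  destruct (excluded_middle_informative (lt eta x)); [apply E | reflexivity].
Qed.

(** [epsilon] makes the recursion pick a permitted value whenever one exists; the locality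
    hypothesis lets [P] pass between the full history and its restriction. *)
Lemma transfinite_choice (P : T -> (T -> A) -> A -> Prop) :
  (forall xi h h' a, (forall eta, lt eta xi -> h eta = h' eta) -> P xi h a -> P xi h' a) ->
  (forall xi h, (forall eta, lt eta xi -> P eta h (h eta)) -> exists a, P xi h a) ->
  exists Y, forall xi, P xi Y (Y xi).
Proof.
  intros loc ex.
  destruct (transfinite_recursion (fun xi h => epsilon (inhabits a0) (P xi h))) as [Y HY].
  exists Y; intro xi.
  induction xi as [xi IH] using (well_founded_ind (wo_wf wo)).
  apply loc with (h := restrict xi Y); [intros; apply restrict_lt; assumption |].
  rewrite HY; apply epsilon_spec, ex.
  intros eta Heta; rewrite (restrict_lt _ _ _ Heta).
  apply loc with (h := Y); [| exact (IH eta Heta)].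
  intros zeta Hz; symmetry; apply restrict_lt; exact (wo_trans wo _ _ _ Hz Heta).
Qed.
End WellOrders.

(** * Lexicographic and induced well-orders *)

Definition lex {A B : Type} (ltA : A -> A -> Prop) (ltB : B -> B -> Prop) (p q : A * B) : Prop :=
  ltA (fst p) (fst q) \/ (fst p = fst q /\ ltB (snd p) (snd q)).

Lemma lex_wo {A B : Type} (ltA : A -> A -> Prop) (ltB : B -> B -> Prop) :
  WellOrder ltA -> WellOrder ltB -> WellOrder (lex ltA ltB).
Proof.
  intros wa wb; split.
  - intros [a b]; revert b.
    induction a as [a IHa] using (well_founded_ind (wo_wf wa)); intro b.
    induction b as [b IHb] using (well_founded_ind (wo_wf wb)).
    constructor; intros [a' b'] [H | [H H']]; simpl in *.
    + exact (IHa a' H b').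
    + subst a'; exact (IHb b' H').
  - intros [a b] [a' b'] [a'' b''] [H | [H H']] [H0 | [H0 H0']]; unfold lex; simpl in *; subst.
    + left; exact (wo_trans wa _ _ _ H H0).
    + left; assumption.
    + left; assumption.
    + right; split; [reflexivity | exact (wo_trans wb _ _ _ H' H0')].
  - intros [a b] [a' b']; unfold lex; simpl.
    destruct (wo_total wa a a') as [H | [-> | H]]; [tauto | | tauto].
    destruct (wo_total wb b b') as [H | [-> | H]]; tauto.
Qed.

Lemma inj_wo {A B : Type} (f : A -> B) (lt : B -> B -> Prop) :
  (forall a a', f a = f a' -> a = a') -> WellOrder lt ->
  WellOrder (fun a a' => lt (f a) (f a')).
Proof.
  intros inj wo; split.
  - apply (wf_inverse_image _ _ lt f (wo_wf wo)).
  - intros x y z; apply (wo_trans wo).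
  - intros x y; destruct (wo_total wo (f x) (f y)) as [H | [H | H]]; auto.
Qed.

Ltac know P :=
  match goal with
  | _ : P |- _ => fail 1
  | _ => idtac
  end.

(* Decides goals [lt], [le], [False] from the [lt], [le] and [=] facts in context. *)
Ltac order wo :=
  let lt := match type of wo with WellOrder ?lt => lt end in
  let T := match type of lt with ?T -> _ => T end in

  solve [
  match goal with
  | |- lt ?x ?y => destruct (le_or_lt wo y x); [exfalso | assumption]
  | |- le lt ?x ?y => destruct (le_or_lt wo x y); [assumption | exfalso]
  | |- _ => exfalso
  end;
  repeat match goal with
  | H : @eq T ?x ?y |- _ =>
      pose proof (eq_le (lt:=lt) x y H); pose proof (eq_le (lt:=lt) y x (eq_sym H)); clear H
  end;
  repeat (match goal with
  | H : lt ?x ?x |- _ => destruct (lt_irrefl wo x H)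
  | H : lt ?x ?y, H' : lt ?y ?z |- _ => know (lt x z); pose proof (wo_trans wo _ _ _ H H')
  | H : lt ?x ?y, H' : le lt ?y ?z |- _ => know (lt x z); pose proof (lt_le_trans wo _ _ _ H H')
  | H : le lt ?x ?y, H' : lt ?y ?z |- _ => know (lt x z); pose proof (le_lt_trans wo _ _ _ H H')
  | H : le lt ?x ?y, H' : le lt ?y ?z |- _ => know (le lt x z); pose proof (le_trans wo _ _ _ H H')
  end)].

(** * Cardinal arithmetic below a successor cardinal *)

Section Cardinals.
Context {N : Type} {ltN : N -> N -> Prop} {K : Type} {ltK : K -> K -> Prop}.
Context (Hnu : infinite_cardinal ltN) (Hreg : regular ltN).
Context (Hkappa : is_successor_cardinal_of ltK N) (Hpow : bijects (N -> bool) K).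

Let HN : WellOrder ltN := proj1 Hnu.
Let HK : WellOrder ltK := proj1 Hkappa.

Lemma no_injection_below (x : N) (g : N -> N) :
  (forall i, ltN (g i) x) -> ~ (forall i j, g i = g j -> i = j).
Proof.
  intros Hg inj; apply (proj2 (proj2 Hnu) x).
  exists (fun i => exist _ (g i) (Hg i)).
  intros i j E; apply inj; exact (f_equal (@proj1_sig _ _) E).
Qed.

Lemma injection_into_unbounded (S : N -> Prop) :
  (forall x, exists y, S y /\ le ltN x y) ->
  exists g : N -> N, (forall i j, g i = g j -> i = j) /\ forall i, S (g i).
Proof.
  intro HS; destruct (Hreg S) as [g Hg].
  - intro x; destruct (HS x) as [y [Sy [H | H]]]; exists y; auto.
  - exists (fun i => proj1_sig (g i)); split.
    + intros i j E; apply Hg; destruct (g i) as [a Ha], (g j) as [b Hb]; simpl in E; subst b.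
      f_equal; apply proof_irrelevance.
    + intro i; exact (proj2_sig (g i)).
Qed.

Lemma nu_nontrivial : exists n0 n1 : N, n0 <> n1.
Proof.
  destruct (proj1 (proj2 Hnu)) as [f Hf]; exists (f 0), (f 1); intro E; discriminate (Hf _ _ E).
Qed.

Lemma nu_no_max (x : N) : exists y, ltN x y.
Proof.
  apply NNPP; intro Hn.
  destruct (injection_into_unbounded (fun y => y = x)) as [g [Hg Hx]].
  - intro y; exists x; split; [reflexivity |].
    destruct (le_or_lt HN y x) as [H | H]; [exact H | destruct Hn; exists y; exact H].
  - destruct nu_nontrivial as [n0 [n1 Hne]]; apply Hne, Hg; rewrite !Hx; reflexivity.
Qed.

(* By regularity: a union of fewer than [nu] sets of size less than [nu] has size less than [nu]. *)
Lemma square_below_small (m : N) (j : N -> N * N) :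
  (forall i, ltN (fst (j i)) m /\ ltN (snd (j i)) m) ->
  ~ (forall i i', j i = j i' -> i = i').
Proof.
  intros Hm inj.
  (* A fibre of the first coordinate is bounded: on an unbounded one, regularity and the second
     coordinate would inject [N] below [m]. *)
  assert (Hb : forall a, exists b, forall i, fst (j i) = a -> ltN i b).
  { intro a; apply NNPP; intro Hn.
    destruct (injection_into_unbounded (fun i => fst (j i) = a)) as [g [Hg Ha]].
    - intro x; apply NNPP; intro Hx; apply Hn; exists x; intros i Hi.
      destruct (le_or_lt HN x i) as [H | H]; [| exact H].
      destruct Hx; exists i; split; assumption.
    - apply (no_injection_below m (fun i => snd (j (g i)))); [intro; apply Hm |].
      intros i i' E; apply Hg, inj, injective_projections; [rewrite !Ha; reflexivity | exact E]. }
  apply choice in Hb; destruct Hb as [bnd Hbnd].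
  destruct (injection_into_unbounded (fun b => exists a, ltN a m /\ b = bnd a)) as [g [Hg Ha]].
  - intro x; exists (bnd (fst (j x))); split.
    + exists (fst (j x)); split; [apply Hm | reflexivity].
    + left; apply Hbnd; reflexivity.
  - apply choice in Ha; destruct Ha as [a Ha].
    apply (no_injection_below m a); [intro; apply Ha |].
    intros i i' E; apply Hg; rewrite (proj2 (Ha i)), (proj2 (Ha i')), E; reflexivity.
Qed.

Definition pair_max (p : N * N) : N :=
  if excluded_middle_informative (ltN (fst p) (snd p)) then snd p else fst p.

Lemma pair_max_ge p : le ltN (fst p) (pair_max p) /\ le ltN (snd p) (pair_max p).
Proof.
  unfold pair_max; destruct (excluded_middle_informative (ltN (fst p) (snd p))).
  - split; order HN.
  - split; [order HN |].
    destruct (le_or_lt HN (snd p) (fst p)); [assumption | contradiction].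
Qed.

(* Goedel's well-ordering of pairs has initial segments smaller than [nu]. *)
Lemma pairing : exists p : N * N -> N, forall x y, p x = p y -> x = y.
Proof.
  pose (key := fun q : N * N => (pair_max q, q)).
  pose (ltG := fun q q' => lex ltN (lex ltN ltN) (key q) (key q')).
  assert (HG : WellOrder ltG).
  { apply (inj_wo key); [| exact (lex_wo _ _ HN (lex_wo _ _ HN HN))].
    intros q q' E; exact (f_equal snd E). }
  destruct nu_nontrivial as [n0 _].
  (* [Y] sends each pair to a value not taken by a smaller pair; if none were left, [s] would inject
     [N] into the square below [m]. *)
  destruct (transfinite_choice HG n0 (fun q h n => forall q', ltG q' q -> h q' <> n)) as [Y HY].
  - intros q h h' n E H q' Hq'; rewrite <- (E q' Hq'); exact (H q' Hq').
  - intros q h _; apply NNPP; intro Hn.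
    assert (Hs : forall n, exists q', ltG q' q /\ h q' = n).
    { intro n; apply NNPP; intro H; apply Hn; exists n; intros q' Hq' E.
      apply H; exists q'; split; assumption. }
    apply choice in Hs; destruct Hs as [s Hs].
    destruct (nu_no_max (pair_max q)) as [m Hm].
    apply (square_below_small m s).
    + intro i; destruct (pair_max_ge (s i)) as [H1 H2].
      assert (le ltN (pair_max (s i)) (pair_max q)).
      { destruct (Hs i) as [[H | [H _]] _]; simpl in H; [left | right]; exact H. }
      split; order HN.
    + intros i i' E; rewrite <- (proj2 (Hs i)), <- (proj2 (Hs i')), E; reflexivity.
  - exists Y; intros x y E.
    destruct (wo_total HG x y) as [H | [H | H]]; [| exact H |].
    + destruct (HY y x H E).
    + destruct (HY x y H (eq_sym E)).
Qed.

Lemma segment_injection (x : K) :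
  exists g : K -> N, forall a b, ltK a x -> ltK b x -> g a = g b -> a = b.
Proof.
  destruct (proj1 (proj2 Hkappa) x) as [g Hg], nu_nontrivial as [n0 _].
  exists (fun a => match excluded_middle_informative (ltK a x) with
                   | left p => g (exist _ a p)
                   | right _ => n0
                   end).
  intros a b Ha Hb.
  destruct (excluded_middle_informative (ltK a x)); [| contradiction].
  destruct (excluded_middle_informative (ltK b x)); [| contradiction].
  intro E; exact (f_equal (@proj1_sig _ _) (Hg _ _ E)).
Qed.

Lemma kappa_not_small (g : K -> N) : ~ (forall a b, g a = g b -> a = b).
Proof. intro H; apply (proj2 (proj2 Hkappa)); exists g; exact H. Qed.

(** Regularity of a successor cardinal: were [h] unbounded, each [c] would be determined by an index
    [k c] with [c] at most [h (k c)] and by a code in [N] relative to [h (k c)], which would inject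
    [K] into [N]. *)
Lemma kappa_bounded (h : N -> K) : exists c, forall i, ltK (h i) c.
Proof.
  apply NNPP; intro Hn.
  assert (Hk : forall c, exists i, le ltK c (h i)).
  { intro c; apply NNPP; intro H; apply Hn; exists c; intro i.
    destruct (le_or_lt HK c (h i)) as [H' | H']; [destruct H; exists i |]; assumption. }
  apply choice in Hk; destruct Hk as [k Hk].
  destruct (choice _ segment_injection) as [g Hg].
  destruct nu_nontrivial as [n0 [n1 Hne]], pairing as [p Hp].
  (* [segment_injection] only covers points strictly below [h (k c)]; the tags [n0] and [n1]
     separate the case of equality. *)
  apply (kappa_not_small (fun c => p (k c, if excluded_middle_informative (c = h (k c))
                                           then p (n0, n0) else p (n1, g (h (k c)) c)))).
  intros a b E; apply Hp in E; injection E as E1 E2; rewrite <- E1 in E2.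
  destruct (Hk a) as [Ha | Ha], (Hk b) as [Hb | Hb]; rewrite <- E1 in Hb;
  destruct (excluded_middle_informative (a = h (k a))) as [Ha' | Ha'],
           (excluded_middle_informative (b = h (k a))) as [Hb' | Hb'];
  try congruence; apply Hp in E2; try congruence.
  injection E2 as E2; exact (Hg _ _ _ Ha Hb E2).
Qed.

Lemma kappa_bounded_segment (x : K) (h : K -> K) :
  exists c, forall y, ltK y x -> ltK (h y) c.
Proof.
  destruct (segment_injection x) as [g Hg].
  assert (Hs : forall n, exists c, forall y, ltK y x -> g y = n -> h y = c).
  { intro n; destruct (classic (exists y, ltK y x /\ g y = n)) as [[y [Hy E]] | Hn].
    - exists (h y); intros z Hz Ez; f_equal; apply Hg; congruence.
    - exists x; intros z Hz Ez; destruct Hn; exists z; split; assumption. }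
  apply choice in Hs; destruct Hs as [s Hs].
  destruct (kappa_bounded s) as [c Hc]; exists c; intros y Hy.
  rewrite (Hs (g y) y Hy eq_refl); apply Hc.
Qed.

Lemma kappa_above (x y : K) : exists z, ltK x z /\ ltK y z.
Proof.
  destruct (kappa_bounded (fun _ => x)) as [c Hc], (kappa_bounded (fun _ => y)) as [d Hd].
  destruct nu_nontrivial as [n _]; specialize (Hc n); specialize (Hd n).
  destruct (le_or_lt HK c d); [exists d | exists c]; split; order HK.
Qed.

Lemma increasing_ge (d : K -> K) :
  (forall eta xi, ltK eta xi -> ltK (d eta) (d xi)) -> forall xi, le ltK xi (d xi).
Proof.
  intros Hd xi; induction xi as [xi IH] using (well_founded_ind (wo_wf HK)).
  destruct (le_or_lt HK xi (d xi)) as [H | H]; [exact H |].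
  specialize (IH _ H); specialize (Hd _ _ H); order HK.
Qed.

Lemma increasing_lt_inv (d : K -> K) :
  (forall eta xi, ltK eta xi -> ltK (d eta) (d xi)) ->
  forall eta xi, ltK (d eta) (d xi) -> ltK eta xi.
Proof.
  intros Hd eta xi H; destruct (le_or_lt HK xi eta) as [[H' | ->] | H']; [| | exact H'].
  - specialize (Hd _ _ H'); order HK.
  - order HK.
Qed.

Lemma increasing_inj (d : K -> K) :
  (forall eta xi, ltK eta xi -> ltK (d eta) (d xi)) ->
  forall eta xi, d eta = d xi -> eta = xi.
Proof.
  intros Hd eta xi E; destruct (wo_total HK eta xi) as [H | [H | H]]; [| exact H |];
  specialize (Hd _ _ H); order HK.
Qed.

Lemma kappa_not_below (x : K) (h : K -> K) :
  (forall y, ltK (h y) x) -> ~ (forall a b, h a = h b -> a = b).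
Proof.
  intros Hx inj; destruct (segment_injection x) as [g Hg].
  apply (kappa_not_small (fun y => g (h y))); intros a b E; apply inj, Hg; auto.
Qed.

Lemma kappa_inhabited : inhabited K.
Proof. destruct Hpow as [b _]; exact (inhabits (b (fun _ => true))). Qed.

(** [e] is the increasing enumeration; if it missed some [s] in [S], minimality would keep all its
    values below [s], which has too few predecessors. *)
Lemma unbounded_bijection (S : K -> Prop) :
  (forall x, exists y, S y /\ le ltK x y) ->
  exists e : K -> K, (forall k, S (e k)) /\ (forall k k', e k = e k' -> k = k') /\
    (forall s, S s -> exists k, e k = s).
Proof.
  intro HS; destruct kappa_inhabited as [k0].
  destruct (transfinite_choice HK k0 (fun k h s =>
     (S s /\ (forall k', ltK k' k -> ltK (h k') s)) /\
     forall t, S t /\ (forall k', ltK k' k -> ltK (h k') t) -> le ltK s t)) as [e He].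
  - intros k h h' s E [[H1 H2] H3]; repeat split.
    + exact H1.
    + intros k' Hk; rewrite <- (E k' Hk); exact (H2 k' Hk).
    + intros t [Ht1 Ht2]; apply H3; split; [exact Ht1 |].
      intros k' Hk; rewrite (E k' Hk); exact (Ht2 k' Hk).
  - intros k h _; apply (least HK).
    destruct (kappa_bounded_segment k h) as [c Hc], (HS c) as [s [Ss Hs]].
    exists s; split; [exact Ss |]; intros k' Hk; specialize (Hc k' Hk); order HK.
  - assert (Hinc : forall k k', ltK k k' -> ltK (e k) (e k')).
    { intros k k' H; destruct (He k') as [[_ H'] _]; exact (H' k H). }
    exists e; split; [intro k; apply He |]; split; [exact (increasing_inj e Hinc) |].
    intros s Ss; apply NNPP; intro Hn.
    apply (kappa_not_below s e); [| exact (increasing_inj e Hinc)].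
    intro k; induction k as [k IH] using (well_founded_ind (wo_wf HK)).
    destruct (proj2 (He k) s (conj Ss IH)) as [H | H]; [exact H |].
    destruct Hn; exists k; exact H.
Qed.

(** A Cantor-Bernstein argument: [i] provides so many values of [j] on [S] that they are unbounded
    in [K], hence enumerated by [K]. *)
Lemma bijection_onto {A : Type} (S : A -> Prop) (j : A -> K) (i : K -> A) :
  (forall a a', S a -> S a' -> j a = j a' -> a = a') ->
  (forall k, S (i k)) -> (forall k k', i k = i k' -> k = k') ->
  exists e : K -> A, (forall k, S (e k)) /\ (forall k k', e k = e k' -> k = k') /\
    (forall a, S a -> exists k, e k = a).
Proof.
  intros Hj Si Hi.
  destruct (unbounded_bijection (fun k => exists a, S a /\ j a = k)) as [e [He [Hinj Hsurj]]].
  - intro x; apply NNPP; intro Hn.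
    apply (kappa_not_below x (fun k => j (i k))).
    + intro k; destruct (le_or_lt HK x (j (i k))) as [H | H]; [| exact H].
      destruct Hn; exists (j (i k)); split; [| exact H].
      exists (i k); split; [apply Si | reflexivity].
    + intros a b E; apply Hi, Hj; auto.
  - apply choice in He; destruct He as [a Ha].
    exists a; split; [intro k; apply Ha |]; split.
    + intros k k' E; apply Hinj; rewrite <- (proj2 (Ha k)), <- (proj2 (Ha k')), E; reflexivity.
    + intros x Sx; destruct (Hsurj (j x)) as [k Hk]; [exists x; split; trivial |].
      exists k; apply Hj; [apply Ha | exact Sx | rewrite (proj2 (Ha k)); exact Hk].
Qed.

Lemma kappa_coding {I : Type} (q : I -> N) :
  (forall i i', q i = q i' -> i = i') ->
  exists c : (I -> Prop) -> K, forall S S', c S = c S' -> S = S'.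
Proof.
  intro Hq; destruct Hpow as [b [Hb _]].
  exists (fun S => b (fun n => if excluded_middle_informative (exists i, q i = n /\ S i)
                               then true else false)).
  intros S S' E; apply Hb in E; apply functional_extensionality; intro i.
  apply (f_equal (fun f => f (q i))) in E; simpl in E.
  apply propositional_extensionality.
  destruct (excluded_middle_informative (exists i0, q i0 = q i /\ S i0)) as [H | H],
    (excluded_middle_informative (exists i0, q i0 = q i /\ S' i0)) as [H' | H'];
    try discriminate.
  - destruct H as [i0 [E0 H]], H' as [i1 [E1 H']]; apply Hq in E0, E1; subst; tauto.
  - split; intro Hs; exfalso; [apply H | apply H']; exists i; tauto.
Qed.

(** * Limit points and clubs *)

Definition limit_closure (S : K -> Prop) (x : K) : Prop := S x \/ limit_point ltK S x.

Lemma limit_dense gamma beta :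
  is_limit ltK gamma -> ltK beta gamma -> exists xi, ltK beta xi /\ ltK xi gamma.
Proof.
  intros [_ Hl] Hb; apply NNPP; intro Hn; apply Hl; exists beta; split; [exact Hb |].
  intros xi H1 H2; apply Hn; exists xi; split; assumption.
Qed.

Lemma limit_point_above S gamma beta :
  limit_point ltK S gamma -> ltK beta gamma ->
  exists s, S s /\ ltK beta s /\ ltK s gamma.
Proof.
  intros [Hl Hu] Hb; destruct (limit_dense _ _ Hl Hb) as [b [H1 H2]].
  destruct (Hu b H2) as [s [Ss [H3 H4]]]; exists s; repeat split; [exact Ss | order HK | exact H4].
Qed.

Lemma limit_point_mono (S S' : K -> Prop) gamma :
  (forall x, ltK x gamma -> S x -> S' x) -> limit_point ltK S gamma -> limit_point ltK S' gamma.
Proof.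
  intros H [Hl Hu]; split; [exact Hl |].
  intros b Hb; destruct (Hu b Hb) as [s [Ss [H1 H2]]]; exists s; auto.
Qed.

Lemma limit_closure_mono (S S' : K -> Prop) x :
  (forall z, le ltK z x -> S z -> S' z) -> limit_closure S x -> limit_closure S' x.
Proof.
  intros H [Sx | Hl]; [left; apply H; [right; reflexivity | exact Sx] | right].
  revert Hl; apply limit_point_mono; intros z Hz; apply H; left; exact Hz.
Qed.

Lemma limit_point_closure S gamma :
  limit_point ltK (limit_closure S) gamma -> limit_point ltK S gamma.
Proof.
  intros Hl; split; [apply Hl |]; intros b Hb.
  destruct (limit_point_above _ _ _ Hl Hb) as [s [[Ss | Hs] [H1 H2]]].
  - exists s; repeat split; [exact Ss | left; exact H1 | exact H2].
  - destruct (proj2 Hs b H1) as [t [St [H3 H4]]].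
    exists t; repeat split; [exact St | exact H3 | order HK].
Qed.

Lemma limit_closure_club S gamma :
  limit_point ltK S gamma -> club_in ltK (fun x => limit_closure S x /\ ltK x gamma) gamma.
Proof.
  intros [Hl Hu]; repeat split.
  - intros x [_ H]; exact H.
  - intros b Hb; destruct (Hu b Hb) as [s [Ss [H1 H2]]].
    exists s; repeat split; [left; exact Ss | exact H2 | exact H1 | exact H2].
  - right; apply limit_point_closure; split; [assumption |].
    intros b Hb; destruct (H1 b Hb) as [s [[Ss _] H2]]; exists s; split; assumption.
  - assumption.
Qed.

(** The least indices [i] with [s] at most [f i], for [s] in [S] below [alpha], are unbounded in
    [N]; regularity picks as many distinct ones as [N] has elements, and [q] would send their points
    injectively below [x]. *)
Lemma cofinal_no_small_set (f : N -> K) alpha (S : K -> Prop) (q : K -> N) (x : N) :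
  cofinal_map ltK ltN f alpha -> unbounded_in ltK S alpha ->
  (forall s, S s -> ltK s alpha -> ltN (q s) x) ->
  ~ (forall s t, S s -> ltK s alpha -> S t -> ltK t alpha -> q s = q t -> s = t).
Proof.
  intros [Hf [Hlt Hcof]] Hu Hq inj.
  pose (T := fun i => exists s, (S s /\ ltK s alpha) /\
                       le ltK s (f i) /\ forall i', le ltK s (f i') -> le ltN i i').
  destruct (injection_into_unbounded T) as [g [Hg HT]].
  - intro i; destruct (nu_no_max i) as [i' Hi].
    destruct (Hu _ (Hlt i')) as [s [Ss [H1 H2]]].
    destruct (least HN (fun i => le ltK s (f i)) (Hcof s H2)) as [k [Hk Hm]].
    exists k; split; [exists s; repeat split; assumption |].
    destruct (le_or_lt HN i k) as [H | H]; [exact H |].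
    assert (H' : ltN k i') by order HN; apply Hf in H'; order HK.
  - apply choice in HT; destruct HT as [s Hs].
    apply (no_injection_below x (fun i => q (s i))); [intro i; apply Hq; apply Hs |].
    intros i i' E; apply Hg.
    destruct (Hs i) as [[H1 H2] [H3 H4]], (Hs i') as [[H1' H2'] [H3' H4']].
    apply inj in E; try assumption; rewrite <- E in *.
    specialize (H4 _ H3'); specialize (H4' _ H3).
    destruct (wo_total HN (g i) (g i')) as [H | [H | H]]; [order HN | exact H | order HN].
Qed.

(** The second clause of [cof_is_nu] is automatic: the range of a shorter cofinal map would be a
    small unbounded set. *)
Lemma cofinal_cof (f : N -> K) alpha : cofinal_map ltK ltN f alpha -> cof_is_nu ltN ltK alpha.
Proof.
  intro Hf; split; [exists f; exact Hf |].
  intros x [g [_ [Hlt Hcof]]].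
  destruct (choice (fun s n => (exists j, g j = s) -> exists j, g j = s /\ proj1_sig j = n)) as [q Hq].
  { intro s; destruct (classic (exists j, g j = s)) as [[j Hj] | Hn].
    - exists (proj1_sig j); intros _; exists j; split; trivial.
    - destruct nu_nontrivial as [n _]; exists n; intro; contradiction. }
  apply (cofinal_no_small_set f alpha (fun s => exists j, g j = s) q x Hf).
  - intros b Hb; destruct (Hcof b Hb) as [j Hj]; exists (g j); repeat split; auto.
    exists j; reflexivity.
  - intros s Ss _; destruct (Hq s Ss) as [j [_ <-]]; exact (proj2_sig j).
  - intros s t Ss _ St _ E; destruct (Hq s Ss) as [j [<- Ej]], (Hq t St) as [k [<- Ek]].
    f_equal; destruct j as [j Hj], k as [k Hk]; simpl in *.
    assert (j = k) by congruence; subst k; f_equal; apply proof_irrelevance.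
Qed.

Lemma increasing_sup (f : N -> K) :
  (forall i j, ltN i j -> ltK (f i) (f j)) ->
  exists gamma, is_limit ltK gamma /\ cofinal_map ltK ltN f gamma.
Proof.
  intro Hf; destruct (least HK (fun c => forall i, ltK (f i) c) (kappa_bounded f)) as [c [Hc Hm]].
  assert (Hcof : forall b, ltK b c -> exists i, le ltK b (f i)).
  { intros b Hb; apply NNPP; intro Hn.
    assert (le ltK c b); [| order HK].
    apply Hm; intro i; destruct (le_or_lt HK b (f i)); [| assumption].
    destruct Hn; exists i; assumption. }
  exists c; repeat split; auto.
  - destruct nu_nontrivial as [n _]; exists (f n); apply Hc.
  - intros [b [Hb Hs]]; destruct (Hcof b Hb) as [i Hi], (nu_no_max i) as [j Hj].
    specialize (Hf _ _ Hj); apply (Hs (f j)); [order HK | apply Hc].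
Qed.

(** [gamma] is the supremum of an increasing [N]-sequence above [a] in which each term exceeds [F]
    of all earlier terms. *)
Lemma limit_closed_under (F : K -> K) (a : K) :
  exists gamma, ltK a gamma /\ is_limit ltK gamma /\ cof_is_nu ltN ltK gamma /\
    forall b, ltK b gamma -> exists b', le ltK b b' /\ ltK (F b') gamma.
Proof.
  destruct (transfinite_choice HN a (fun i f v => ltK a v /\
              forall j, ltN j i -> ltK (f j) v /\ ltK (F (f j)) v)) as [f Hf].
  - intros i f f' v E [H1 H2]; split; [exact H1 |].
    intros j Hj; rewrite <- (E j Hj); exact (H2 j Hj).
  - intros i f _; destruct (kappa_bounded f) as [c Hc], (kappa_bounded (fun j => F (f j))) as [d Hd].
    destruct (kappa_above c d) as [e [H1 H2]], (kappa_above e a) as [v [H3 H4]].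
    exists v; split; [exact H4 |]; intros j _; specialize (Hc j); specialize (Hd j); simpl in Hd.
    split; order HK.
  - destruct (increasing_sup f) as [c [Hl Hc]].
    { intros i j H; apply Hf; exact H. }
    exists c; split; [| split; [exact Hl | split; [exact (cofinal_cof f c Hc) |]]].
    + destruct nu_nontrivial as [n _]; destruct (Hf n) as [H _].
      pose proof (proj1 (proj2 Hc) n); order HK.
    + intros b Hb; destruct (proj2 (proj2 Hc) b Hb) as [i Hi], (nu_no_max i) as [j Hj].
      exists (f i); split; [exact Hi |].
      pose proof (proj1 (proj2 Hc) j); destruct (proj2 (Hf j) i Hj); order HK.
Qed.

Definition unbounded (S : K -> Prop) : Prop := forall b, exists x, S x /\ le ltK b x.

Lemma common_limit_point (S S' : K -> Prop) (a : K) :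
  unbounded S -> unbounded S' ->
  exists gamma, ltK a gamma /\ cof_is_nu ltN ltK gamma /\
    limit_point ltK S gamma /\ limit_point ltK S' gamma.
Proof.
  intros HS HS'.
  (* [F] jumps from [b] past a point of each set, so a limit provided by [limit_closed_under] is a
     limit point of both. *)
  destruct (choice (fun b c => (exists x, S x /\ le ltK b x /\ ltK x c) /\
                               (exists x, S' x /\ le ltK b x /\ ltK x c))) as [F HF].
  { intro b; destruct (HS b) as [x [Sx Hx]], (HS' b) as [y [Sy Hy]], (kappa_above x y) as [c [H1 H2]].
    exists c; split; [exists x | exists y]; auto. }
  destruct (limit_closed_under F a) as [c [Ha [Hl [Hcof Hc]]]].
  exists c; split; [exact Ha | split; [exact Hcof |]].
  split; (split; [exact Hl |]);
  intros b Hb; destruct (Hc b Hb) as [b' [H1 H2]]; destruct (HF b') as [[x Hx] [y Hy]];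
  [exists x; destruct Hx as [Sx [H3 H4]] | exists y; destruct Hy as [Sx [H3 H4]]];
  (repeat split; [exact Sx | order HK | order HK]).
Qed.

(* Enumerate [gamma] in type at most [nu] by [g] and keep the points that exceed everything enumerated
   before them: they form a cofinal set on which [g] is order preserving. *)
Lemma ladder_at (gamma : K) : is_limit ltK gamma ->
  exists c, club_in ltK c gamma /\
    forall alpha, ltK alpha gamma -> limit_point ltK c alpha -> ~ cof_is_nu ltN ltK alpha.
Proof.
  intro Hl; destruct (segment_injection gamma) as [g Hg].
  pose (c0 := fun b => ltK b gamma /\ forall a, ltK a gamma -> ltN (g a) (g b) -> ltK a b).
  assert (Hu : unbounded_in ltK c0 gamma).
  { intros a Ha.
    (* Among the points of [gamma] from [a] on, take the [b] enumerated first: whatever [g] puts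
       before [b] lies below [a]. *)
    destruct (least HN (fun n => exists b, le ltK a b /\ ltK b gamma /\ g b = n)) as [n [[b [H1 [H2 E]]] Hm]].
    { exists (g a), a; repeat split; [right; reflexivity | exact Ha]. }
    exists b; repeat split; try assumption.
    intros a' Ha' Hlt; destruct (le_or_lt HK b a') as [H | H]; [| exact H].
    assert (le ltN n (g a')); [| order HN].
    apply Hm; exists a'; repeat split; [order HK | exact Ha']. }
  exists (fun x => limit_closure c0 x /\ ltK x gamma); split; [apply limit_closure_club; split; assumption |].
  intros alpha Ha Hla [[f Hf] _].
  assert (Hlc : limit_point ltK c0 alpha).
  { apply limit_point_closure; revert Hla; apply limit_point_mono; tauto. }
  (* All points of [c0] below [alpha] get [g]-values below [g b], because [g] is increasing on [c0];
     so few points cannot be cofinal in [alpha]. *)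
  destruct (Hu alpha Ha) as [b [[_ Hb] [H1 H2]]].
  apply (cofinal_no_small_set f alpha c0 g (g b) Hf (proj2 Hlc)).
  - intros s [Hs1 Hs2] Hsa; destruct (wo_total HN (g s) (g b)) as [H | [H | H]]; [exact H | |].
    + apply Hg in H; try assumption; order HK.
    + apply Hs2 in H; [order HK | exact H2].
  - intros s t [Hs _] _ [Ht _] _; apply Hg; assumption.
Qed.

(** With such sets as default values, coherence at a default index holds vacuously, whatever stands
    at smaller indices. *)
Definition ladder_system (L : K -> K -> Prop) : Prop :=
  Cseq ltK (fun _ => True) L /\
  forall beta alpha, ltK alpha beta -> limit_point ltK (L beta) alpha -> ~ cof_is_nu ltN ltK alpha.

Lemma ladder_system_exists : exists L, ladder_system L.
Proof.
  assert (H : forall beta, exists c : K -> Prop, (forall xi, c xi -> ltK xi beta) /\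
     (is_limit ltK beta -> club_in ltK c beta) /\
     (forall b, is_succ_of ltK beta b -> forall xi, c xi <-> xi = b) /\
     forall alpha, ltK alpha beta -> limit_point ltK c alpha -> ~ cof_is_nu ltN ltK alpha).
  { intro beta; destruct (classic (is_limit ltK beta)) as [Hl | Hl].
    - destruct (ladder_at beta Hl) as [c [H1 H2]]; exists c; repeat split; try apply H1; try assumption;
      intros; destruct Hl as [_ Hl]; destruct Hl; eexists; eassumption.
    (* This set holds the predecessor of a successor and is empty at the least index. *)
    - exists (is_succ_of ltK beta).
      assert (Hs : forall b, is_succ_of ltK beta b -> forall xi, is_succ_of ltK beta xi <-> xi = b).
      { intros b [Hb1 Hb2] xi; split; [intros [H1 H2] | intros ->; split; assumption].
        destruct (wo_total HK xi b) as [H | [H | H]]; [| exact H |].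
        - destruct (H2 b H Hb1).
        - destruct (Hb2 xi H H1). }
      split; [intros xi [H _]; exact H | split; [contradiction | split; [exact Hs |]]].
      intros alpha Ha [Hla Hu] _; destruct (proj1 Hla) as [b0 Hb0].
      destruct (Hu b0 Hb0) as [b [Hb [H1 H2]]].
      destruct Hb as [_ Hb]; exact (Hb alpha H2 Ha). }
  apply choice in H; destruct H as [L HL]; exists L; split.
  - intros beta _; destruct (HL beta) as [H1 [H2 [H3 _]]]; auto.
  - intro beta; apply HL.
Qed.

(** * Threads *)

(* The unique club witnessing triviality; unlike a witness in [trivial_seq] it is determined by [C]. *)
Definition thread (C : K -> K -> Prop) (D : K -> Prop) : Prop :=
  club_kappa ltK D /\
  forall gamma, limit_point ltK D gamma -> cof_is_nu ltN ltK gamma ->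
    forall x, C gamma x <-> D x /\ ltK x gamma.

(** Above any [x] the two clubs have a common limit point [gamma] of cofinality [nu], and [C gamma]
    equals both of them below [gamma]. *)
Lemma thread_unique C D D' : thread C D -> thread C D' -> D = D'.
Proof.
  intros [[Hu _] H] [[Hu' _] H'].
  apply functional_extensionality; intro x; apply propositional_extensionality.
  destruct (common_limit_point D D' x Hu Hu') as [gamma [Hx [Hcof [Hl Hl']]]].
  specialize (H _ Hl Hcof x); specialize (H' _ Hl' Hcof x); tauto.
Qed.

(** A club witnessing triviality is merely contained in members of [C]; the thread is the union of
    the [C gamma] over its limit points [gamma] of cofinality [nu]. Conversely a thread is itself a
    witness. *)
Lemma trivial_iff_thread C : Coh ltN ltK C -> (trivial_seq ltK C <-> exists D, thread C D).
Proof.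
  intros [HC Hcoh]; split.
  - intros [C0 [[Hu Hcl] Ht]].
    pose (good := fun gamma => limit_point ltK C0 gamma /\ cof_is_nu ltN ltK gamma).
    assert (Hgood : forall b, exists gamma, ltK b gamma /\ good gamma).
    { intro b; destruct (common_limit_point C0 C0 b Hu Hu) as [gamma [Hb [Hcof [Hl _]]]].
      exists gamma; repeat split; try apply Hcof; try exact Hb; apply Hl. }
    (* Triviality gives the inclusion in some [C beta] with [beta] at least [gamma]; then [gamma] is
       a limit point of [C beta], and coherence brings the inclusion down to [C gamma]. *)
    assert (Hincl : forall gamma x, good gamma -> C0 x -> ltK x gamma -> C gamma x).
    { intros gamma x [Hl Hcof] Hx Hlt; destruct (Ht gamma) as [beta [[Hb | <-] Hs]]; [| auto].
      apply (Hcoh beta gamma I Hb); auto.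
      revert Hl; apply limit_point_mono; auto. }
    assert (Hcmp : forall gamma gamma' x, good gamma -> good gamma' -> ltK gamma gamma' ->
                     (C gamma x <-> C gamma' x /\ ltK x gamma)).
    { intros gamma gamma' x [Hl Hcof] Hg' Hlt; apply (Hcoh gamma' gamma I Hlt); [| exact Hcof].
      revert Hl; apply limit_point_mono; intros z Hz Sz; apply Hincl; [assumption.. | order HK]. }
    pose (D := fun x => exists gamma, good gamma /\ C gamma x).
    assert (HD : forall gamma x, good gamma -> (C gamma x <-> D x /\ ltK x gamma)).
    { intros gamma x Hg; split.
      - intro Hx; split; [exists gamma; split; assumption | exact (proj1 (HC gamma I) x Hx)].
      - intros [[gamma' [Hg' Hx]] Hlt]; destruct (wo_total HK gamma gamma') as [H | [<- | H]].
        + apply (Hcmp gamma gamma'); auto.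
        + exact Hx.
        + apply (Hcmp gamma' gamma) in Hx; tauto. }
    exists D; split; [split |].
    + intro b; destruct (Hgood b) as [gamma [Hb Hg]].
      destruct (proj1 (proj2 (HC gamma I)) (proj1 (proj1 Hg))) as [_ [Hub _]].
      destruct (Hub b Hb) as [x [Hx [H1 H2]]]; exists x; split; [| exact H1].
      exists gamma; split; assumption.
    + intros beta Hbl Hbu; destruct (Hgood beta) as [gamma [Hb Hg]].
      destruct (proj1 (proj2 (HC gamma I)) (proj1 (proj1 Hg))) as [_ [_ Hclosed]].
      exists gamma; split; [exact Hg |]; apply Hclosed; try assumption.
      intros b Hbb; destruct (Hbu b Hbb) as [x [Dx [H1 H2]]]; exists x; repeat split; try assumption.
      apply HD; [exact Hg | split; [exact Dx | order HK]].
    (* [gamma] need not be a limit point of [C0], but below a good [gamma'] above it [C gamma']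
       agrees with [D], so [gamma] is a limit point of [C gamma'] and coherence applies. *)
    + intros gamma Hl Hcof x; destruct (Hgood gamma) as [gamma' [Hlt Hg']].
      rewrite (Hcoh gamma' gamma I Hlt); [| | exact Hcof].
      * rewrite (HD gamma' x Hg'); split; [tauto |].
        intros [H1 H2]; repeat split; [assumption | order HK | assumption].
      * revert Hl; apply limit_point_mono; intros z Hz Dz; apply HD; [exact Hg' | split; [exact Dz | order HK]].
  - intros [D [[Hu Hcl] Ht]]; exists D; split; [split; assumption |].
    intro a; destruct (common_limit_point D D a Hu Hu) as [gamma [Ha [Hcof [Hl _]]]].
    exists gamma; split; [left; exact Ha |]; intros x Dx Hx; apply Ht; auto.
    split; [exact Dx | order HK].
Qed.

(** * Continuation of initial segments by ladders *)

Context (L : K -> K -> Prop) (HL : ladder_system L).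

Lemma ladder_Coh : Coh ltN ltK L.
Proof.
  split; [apply HL |]; intros beta alpha _ Hlt Hl Hcof.
  destruct (proj2 HL beta alpha Hlt Hl Hcof).
Qed.

(** The ladder tail turns an initial segment of a coherent [C] into a coherent sequence of full
    length; the tail being fixed, a truncation is determined by its part below [delta]. *)
Definition trunc (delta : K) (C : K -> K -> Prop) (alpha : K) : K -> Prop :=
  if excluded_middle_informative (ltK alpha delta) then C alpha else L alpha.

Lemma trunc_lt delta C alpha : ltK alpha delta -> trunc delta C alpha = C alpha.
Proof.
  intro H; unfold trunc; destruct (excluded_middle_informative (ltK alpha delta)); tauto.
Qed.

Lemma trunc_ge delta C alpha : le ltK delta alpha -> trunc delta C alpha = L alpha.
Proof.
  intro H; unfold trunc; destruct (excluded_middle_informative (ltK alpha delta)); [| reflexivity].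
  order HK.
Qed.

Lemma trunc_Coh delta C : Coh ltN ltK C -> Coh ltN ltK (trunc delta C).
Proof.
  intros [HC Hcoh]; split.
  - intros alpha _; destruct (le_or_lt HK delta alpha) as [H | H].
    + rewrite (trunc_ge _ _ _ H); apply (proj1 HL alpha I).
    + rewrite (trunc_lt _ _ _ H); apply (HC alpha I).
  - intros beta alpha _ Hlt; destruct (le_or_lt HK delta beta) as [H | H].
    + rewrite (trunc_ge _ _ _ H); intros Hl Hcof; destruct (proj2 HL beta alpha Hlt Hl Hcof).
    + rewrite (trunc_lt _ C _ H), (trunc_lt _ C alpha); [| order HK].
      apply (Hcoh beta alpha I Hlt).
Qed.

(** * Runs *)

(* A stage [(delta, E)] is a coherent sequence [E] of which only the part below [delta] is a commitment. *)
Definition stage : Type := (K * (K -> K -> Prop))%type.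

Definition range (P : K -> Prop) (h : K -> stage) (x : K) : Prop :=
  exists eta, P eta /\ fst (h eta) = x.

Definition below (xi eta : K) : Prop := ltK eta xi.

(* The value prescribed at a limit [gamma] of cofinality [nu] of the chosen points [S]; the unthreaded
   variant produces nontrivial sequences. *)
Definition target (threaded : bool) (S : K -> Prop) (gamma : K) : K -> Prop :=
  if threaded then fun x => limit_closure S x /\ ltK x gamma else L gamma.

(* A stage [a] may follow the stages [h eta], [eta < xi]; values of [h] elsewhere are irrelevant. *)
Record move (threaded : bool) (xi : K) (h : K -> stage) (a : stage) : Prop := {
  move_Coh : Coh ltN ltK (snd a);
  move_ge : forall alpha, le ltK (fst a) alpha -> snd a alpha = L alpha;
  move_lt : forall eta, ltK eta xi -> ltK (fst (h eta)) (fst a);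
  move_ext : forall eta, ltK eta xi ->
    forall alpha, ltK alpha (fst (h eta)) -> snd a alpha = snd (h eta) alpha;
  move_limit_lt : forall gamma, limit_point ltK (range (below xi) h) gamma -> ltK gamma (fst a);
  move_limit : forall gamma, limit_point ltK (range (below xi) h) gamma -> cof_is_nu ltN ltK gamma ->
    snd a gamma = target threaded (range (below xi) h) gamma
}.

Lemma range_ext xi h h' :
  (forall eta, ltK eta xi -> h eta = h' eta) -> range (below xi) h = range (below xi) h'.
Proof.
  intro E; apply functional_extensionality; intro x; apply propositional_extensionality.
  split; intros [eta [H <-]]; exists eta; (split; [exact H |]); rewrite (E _ H); reflexivity.
Qed.

Lemma move_local threaded xi h h' a :
  (forall eta, ltK eta xi -> h eta = h' eta) -> move threaded xi h a -> move threaded xi h' a.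
Proof.
  intros E M; split; try apply M.
  - intros eta H; rewrite <- (E _ H); exact (move_lt _ _ _ _ M eta H).
  - intros eta H; rewrite <- (E _ H); exact (move_ext _ _ _ _ M eta H).
  - rewrite <- (range_ext xi h h' E); apply M.
  - rewrite <- (range_ext xi h h' E); apply M.
Qed.

Lemma target_ext threaded S S' gamma :
  (forall z, ltK z gamma -> (S z <-> S' z)) -> target threaded S gamma = target threaded S' gamma.
Proof.
  intro H; destruct threaded; [| reflexivity].
  apply functional_extensionality; intro x; apply propositional_extensionality; simpl.
  split; intros [H1 H2]; (split; [| exact H2]); revert H1; apply limit_closure_mono;
  intros z Hz; apply H; order HK.
Qed.

Lemma target_club threaded S gamma :
  limit_point ltK S gamma -> club_in ltK (target threaded S gamma) gamma.
Proof.
  intro Hl; destruct threaded; [exact (limit_closure_club S gamma Hl) |].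
  apply (proj1 HL gamma I); apply Hl.
Qed.

(** When threaded, the values are initial segments of one closure; when unthreaded, a ladder has no
    such limit point [alpha]. *)
Lemma target_coherent threaded S beta alpha :
  ltK alpha beta -> limit_point ltK (target threaded S beta) alpha -> cof_is_nu ltN ltK alpha ->
  limit_point ltK S alpha /\
  forall x, target threaded S alpha x <-> target threaded S beta x /\ ltK x alpha.
Proof.
  intros Hlt Hl Hcof; destruct threaded; simpl in *.
  - split.
    + apply limit_point_closure; revert Hl; apply limit_point_mono; tauto.
    + intro x; split; [intros [H1 H2] | tauto]; repeat split; [assumption | order HK | assumption].
  - destruct (proj2 HL beta alpha Hlt Hl Hcof).
Qed.

(** * Amalgamation of the stages of a run *)

Section Glue.
Context (threaded : bool) (P : K -> Prop) (h : K -> stage).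

(** Along a run all stages reaching beyond [alpha] agree there, so any of them may supply the value.
    Where none does, a limit of the chosen points with cofinality [nu] gets its prescribed value in
    advance, and all else gets ladders. *)
Definition glue (alpha : K) : K -> Prop :=
  match excluded_middle_informative (exists eta, P eta /\ ltK alpha (fst (h eta))) with
  | left H => snd (h (proj1_sig (constructive_indefinite_description _ H))) alpha
  | right _ =>
      if excluded_middle_informative (limit_point ltK (range P h) alpha /\ cof_is_nu ltN ltK alpha)
      then target threaded (range P h) alpha else L alpha
  end.

Context (HP : forall eta xi, ltK eta xi -> P xi -> P eta).
Context (Hh : forall eta, P eta -> move threaded eta h (h eta)).

Lemma run_increasing eta xi : P xi -> ltK eta xi -> ltK (fst (h eta)) (fst (h xi)).
Proof. intros Hx H; exact (move_lt _ _ _ _ (Hh xi Hx) eta H). Qed.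

Lemma run_lt_inv eta xi : P eta -> ltK (fst (h eta)) (fst (h xi)) -> ltK eta xi.
Proof.
  intros He H; destruct (wo_total HK eta xi) as [H' | [-> | H']]; [exact H' | order HK |].
  pose proof (run_increasing _ _ He H'); order HK.
Qed.

Lemma range_below eta z : P eta -> ltK z (fst (h eta)) -> (range P h z <-> range (below eta) h z).
Proof.
  intros He Hz; split; intros [zeta [H <-]]; exists zeta; (split; [| reflexivity]).
  - exact (run_lt_inv _ _ H Hz).
  - exact (HP _ _ H He).
Qed.

Lemma glue_below eta alpha : P eta -> ltK alpha (fst (h eta)) -> glue alpha = snd (h eta) alpha.
Proof.
  intros He Ha; unfold glue.
  destruct (excluded_middle_informative _) as [H | H]; [| destruct H; exists eta; split; assumption].
  destruct (constructive_indefinite_description _ H) as [xi [Hx Hxa]]; simpl.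
  destruct (wo_total HK eta xi) as [H' | [-> | H']]; [| reflexivity |].
  - exact (move_ext _ _ _ _ (Hh xi Hx) eta H' alpha Ha).
  - symmetry; exact (move_ext _ _ _ _ (Hh eta He) xi H' alpha Hxa).
Qed.

Lemma glue_limit gamma : limit_point ltK (range P h) gamma -> cof_is_nu ltN ltK gamma ->
  glue gamma = target threaded (range P h) gamma.
Proof.
  intros Hl Hcof; destruct (classic (exists eta, P eta /\ ltK gamma (fst (h eta)))) as [[eta [He Hlt]] | Hn].
  - rewrite (glue_below eta); try assumption.
    assert (Hr : forall z, ltK z gamma -> (range P h z <-> range (below eta) h z)).
    { intros z Hz; apply range_below; [exact He | order HK]. }
    rewrite (target_ext _ _ _ _ Hr).
    apply (move_limit _ _ _ _ (Hh eta He)); [| exact Hcof].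
    revert Hl; apply limit_point_mono; intros z Hz; apply Hr; exact Hz.
  - unfold glue; destruct (excluded_middle_informative _) as [H | _]; [contradiction |].
    destruct (excluded_middle_informative _) as [_ | H]; [reflexivity | destruct H; split; assumption].
Qed.

Lemma glue_cases alpha :
  (exists eta, P eta /\ ltK alpha (fst (h eta)) /\ glue alpha = snd (h eta) alpha) \/
  (limit_point ltK (range P h) alpha /\ glue alpha = target threaded (range P h) alpha) \/
  glue alpha = L alpha.
Proof.
  destruct (classic (exists eta, P eta /\ ltK alpha (fst (h eta)))) as [[eta [He Hlt]] | Hn].
  - left; exists eta; repeat split; try assumption; exact (glue_below eta alpha He Hlt).
  - right; unfold glue; destruct (excluded_middle_informative _) as [H | _]; [contradiction |].
    destruct (excluded_middle_informative _) as [[H _] | _]; tauto.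
Qed.

(** At an index with a prescribed value, limit points of cofinality [nu] are again limits of the
    chosen points, where [glue] also has the prescribed value; ladders have none, and the rest is
    inherited from the stages. *)
Lemma glue_Coh : Coh ltN ltK glue.
Proof.
  split.
  - intros alpha _; destruct (glue_cases alpha) as [[eta [He [Hlt ->]]] | [[Hl ->] | ->]].
    + apply (proj1 (move_Coh _ _ _ _ (Hh eta He)) alpha I).
    + pose proof (target_club threaded _ _ Hl) as Hc; split; [apply Hc | split; [trivial |]].
      intros b Hb; destruct (proj2 (proj1 Hl)); exists b; exact Hb.
    + apply (proj1 HL alpha I).
  - intros beta alpha _ Hlt; destruct (glue_cases beta) as [[eta [He [Hb ->]]] | [[_ ->] | ->]].
    + rewrite (glue_below eta alpha He); [| order HK].
      exact (proj2 (move_Coh _ _ _ _ (Hh eta He)) beta alpha I Hlt).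
    + intros Hl Hcof; destruct (target_coherent _ _ _ _ Hlt Hl Hcof) as [Hl' Ht].
      rewrite (glue_limit alpha Hl' Hcof); exact Ht.
    + intros Hl Hcof; destruct (proj2 HL beta alpha Hlt Hl Hcof).
Qed.
End Glue.

(** Agreement up to and including [g] covers the supremum of the earlier points, where a move may be
    newly constrained; beyond [g] the coherent sequence [G] is free. *)
Lemma move_intro threaded xi h G g delta :
  (forall eta, ltK eta xi -> move threaded eta h (h eta)) -> Coh ltN ltK G ->
  (forall eta, ltK eta xi -> le ltK (fst (h eta)) g /\
     forall alpha, le ltK alpha g -> G alpha = glue threaded (below xi) h alpha) ->
  ltK g delta -> move threaded xi h (delta, trunc delta G).
Proof.
  intros Hh HG Hg Hd.
  assert (HP : forall eta zeta, ltK eta zeta -> below xi zeta -> below xi eta).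
  { unfold below; intros; order HK. }
  assert (Hlim : forall gamma, limit_point ltK (range (below xi) h) gamma -> 
            le ltK gamma g /\ exists eta, ltK eta xi).
  { intros gamma Hl; destruct (proj1 (proj1 Hl)) as [b Hb], (proj2 Hl b Hb) as [x [[eta [He _]] _]].
    split; [| exists eta; exact He].
    destruct (le_or_lt HK gamma g) as [H | H]; [exact H |].
    destruct (limit_point_above (range (below xi) h) gamma g) as [x' [[zeta [Hz <-]] [H1 H2]]].
    - exact Hl.
    - exact H.
    - pose proof (proj1 (Hg zeta Hz)); order HK. }
  split; simpl.
  - exact (trunc_Coh delta G HG).
  - apply trunc_ge.
  - intros eta He; pose proof (proj1 (Hg eta He)); order HK.
  - intros eta He alpha Ha; destruct (Hg eta He) as [H1 H2].
    rewrite trunc_lt; [| order HK]; rewrite H2; [| order HK].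
    apply glue_below; assumption.
  - intros gamma Hl; pose proof (proj1 (Hlim gamma Hl)); order HK.
  - intros gamma Hl Hcof; destruct (Hlim gamma Hl) as [Hle [eta He]].
    rewrite trunc_lt; [| order HK]; rewrite (proj2 (Hg eta He) gamma Hle).
    apply glue_limit; assumption.
Qed.

Lemma run_bounded xi (h : K -> stage) : exists g, forall eta, ltK eta xi -> le ltK (fst (h eta)) g.
Proof.
  destruct (kappa_bounded_segment xi (fun eta => fst (h eta))) as [g Hg].
  exists g; intros eta H; left; exact (Hg eta H).
Qed.

(** * Runs of full length and their limits *)

Definition full (eta : K) : Prop := True.

Definition is_run (threaded : bool) (h : K -> stage) : Prop := forall xi, move threaded xi h (h xi).

Lemma run_increasing_full threaded h : is_run threaded h ->
  forall eta xi, ltK eta xi -> ltK (fst (h eta)) (fst (h xi)).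
Proof. intros Hh eta xi H; exact (move_lt _ _ _ _ (Hh xi) eta H). Qed.

Lemma range_unbounded threaded h : is_run threaded h -> unbounded (range full h).
Proof.
  intros Hh b; exists (fst (h b)); split; [exists b; split; [exact I | reflexivity] |].
  apply (increasing_ge (fun xi => fst (h xi)) (run_increasing_full threaded h Hh)).
Qed.

Definition limit_of_run (threaded : bool) (h : K -> stage) : K -> K -> Prop := glue threaded full h.

Lemma limit_of_run_Coh threaded h : is_run threaded h -> Coh ltN ltK (limit_of_run threaded h).
Proof. intro Hh; apply glue_Coh; [intros; exact I | intros; apply Hh]. Qed.

Lemma limit_of_run_below threaded h : is_run threaded h ->
  forall xi alpha, ltK alpha (fst (h xi)) -> limit_of_run threaded h alpha = snd (h xi) alpha.
Proof. intros Hh xi alpha; apply glue_below; [intros; apply Hh | exact I]. Qed.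

Lemma limit_of_run_limit threaded h : is_run threaded h ->
  forall gamma, limit_point ltK (range full h) gamma -> cof_is_nu ltN ltK gamma ->
  limit_of_run threaded h gamma = target threaded (range full h) gamma.
Proof. intros Hh; apply glue_limit; [intros; exact I | intros; apply Hh]. Qed.

Lemma run_thread h : is_run true h -> thread (limit_of_run true h) (limit_closure (range full h)).
Proof.
  intro Hh; split; [split |].
  - intro b; destruct (range_unbounded true h Hh b) as [x [Hx Hb]]; exists x; split; [left |]; assumption.
  - intros b Hb Hu; right; apply limit_point_closure; split; assumption.
  - intros gamma Hl Hcof x; apply limit_point_closure in Hl.
    rewrite (limit_of_run_limit true h Hh gamma Hl Hcof); reflexivity.
Qed.

Lemma threaded_run_Triv h : is_run true h -> Triv ltN ltK (limit_of_run true h).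
Proof.
  intro Hh; pose proof (limit_of_run_Coh true h Hh) as HC; split; [exact HC |].
  apply trivial_iff_thread; [exact HC |]; eexists; exact (run_thread h Hh).
Qed.

(* If [a1 < a2] are common limit points of a thread and of the run, then [a1] is a limit point of the
   ladder at [a2], contradicting the choice of the ladders. *)
Lemma unthreaded_run_not_Triv h : is_run false h -> ~ Triv ltN ltK (limit_of_run false h).
Proof.
  intros Hh [HC Ht]; apply trivial_iff_thread in Ht; [| exact HC].
  destruct Ht as [D [[Hu _] HD]], kappa_inhabited as [k].
  pose proof (range_unbounded false h Hh) as Hr.
  destruct (common_limit_point D _ k Hu Hr) as [a1 [_ [Hcof1 [Hl1 _]]]].
  destruct (common_limit_point D _ a1 Hu Hr) as [a2 [H12 [Hcof2 [Hl2 Hr2]]]].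
  apply (proj2 HL a2 a1 H12); [| exact Hcof1].
  revert Hl1; apply limit_point_mono; intros x Hx Dx.
  pose proof (HD a2 Hl2 Hcof2 x) as E.
  rewrite (limit_of_run_limit false h Hh a2 Hr2 Hcof2) in E.
  apply E; split; [exact Dx | order HK].
Qed.

(** * The Baire property *)

(** Since [G] is not interior to the closure of [Nd], some coherent sequence close to [G] lies
    outside that closure, and a long enough initial segment of it excludes [Nd]. *)
Lemma nowhere_dense_avoid Nd G g :
  nowhere_dense (Coh ltN ltK) (basic_Coh ltN ltK) Nd -> Coh ltN ltK G ->
  exists G' g', Coh ltN ltK G' /\ ltK g g' /\ (forall alpha, le ltK alpha g -> G' alpha = G alpha) /\
    forall C, Coh ltN ltK C -> (forall alpha, ltK alpha g' -> C alpha = G' alpha) -> ~ Nd C.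
Proof.
  intros [_ Hnd] HG; destruct (kappa_above g g) as [c [Hc _]].
  apply NNPP; intro Hn; apply (Hnd G); split; [exact HG |].
  exists (fun C => Coh ltN ltK C /\ forall alpha, ltK alpha c -> C alpha = G alpha).
  split; [| split; [split; [exact HG | reflexivity] |]].
  - exists c, G; split; [| intro; reflexivity].
    destruct HG as [H1 H2]; split; [intros a _; exact (H1 a I) | intros b a _; exact (H2 b a I)].
  - intros y Hy [_ Hyc]; split; [exact Hy |].
    intros b [d [D [HD Hb]]] Hby; apply NNPP; intro Hno; apply Hn.
    destruct (kappa_above c d) as [g' [H1 H2]].
    exists y, g'; split; [exact Hy | split; [order HK | split]].
    + intros alpha Ha; apply Hyc; order HK.
    + intros C HC E Nc; apply Hno; exists C; split; [exact HC | split; [exact Nc |]].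
      apply Hb; split; [exact HC |]; intros alpha Ha; rewrite E; [| order HK].
      apply (proj1 (Hb y) Hby); exact Ha.
Qed.

(** Stage [xi] extends the amalgam of the earlier stages so as to leave [Nd xi], and commits to
    enough of the result to keep every continuation outside. *)
Lemma generic_run threaded (Nd : K -> (K -> K -> Prop) -> Prop) G0 g0 :
  (forall i, nowhere_dense (Coh ltN ltK) (basic_Coh ltN ltK) (Nd i)) -> Coh ltN ltK G0 ->
  exists h, is_run threaded h /\
    (forall alpha, ltK alpha g0 -> limit_of_run threaded h alpha = G0 alpha) /\
    forall i, ~ Nd i (limit_of_run threaded h).
Proof.
  intros Hnd HG0.
  destruct (transfinite_choice HK (g0, L) (fun xi h a => move threaded xi h a /\ ltK g0 (fst a) /\
     (forall alpha, ltK alpha g0 -> snd a alpha = G0 alpha) /\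
     forall C, Coh ltN ltK C -> (forall alpha, ltK alpha (fst a) -> C alpha = snd a alpha) -> ~ Nd xi C))
    as [h Hh].
  - intros xi h h' a E [M H]; split; [exact (move_local _ _ _ _ _ E M) | exact H].
  - intros xi h Hh.
    assert (Hm : forall eta, ltK eta xi -> move threaded eta h (h eta)) by (intros; apply Hh; assumption).
    assert (HGg : exists G g, Coh ltN ltK G /\ le ltK g0 g /\
       (forall alpha, ltK alpha g0 -> G alpha = G0 alpha) /\
       forall eta, ltK eta xi -> le ltK (fst (h eta)) g /\
         forall alpha, le ltK alpha g -> G alpha = glue threaded (below xi) h alpha).
    { assert (HP : forall eta zeta, ltK eta zeta -> below xi zeta -> below xi eta).
      { unfold below; intros; order HK. }
      destruct (classic (exists eta, ltK eta xi)) as [[eta He] | Hn].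
      - destruct (run_bounded xi h) as [g Hg].
        exists (glue threaded (below xi) h), g; split; [apply glue_Coh; assumption |].
        destruct (Hh eta He) as [_ [H1 [H2 _]]]; specialize (Hg eta He) as Hge.
        split; [order HK | split; [| intros; split; auto]].
        intros alpha Ha; rewrite (glue_below threaded (below xi) h Hm eta alpha He); [auto | order HK].
      (* At the first stage there is nothing to amalgamate, and [G0] itself is the starting
         point. *)
      - exists G0, g0; split; [exact HG0 | split; [right; reflexivity | split; [reflexivity |]]].
        intros eta He; destruct Hn; exists eta; exact He. }
    destruct HGg as [G [g [HG [Hg [HG0' Hglue]]]]].
    destruct (nowhere_dense_avoid (Nd xi) G g (Hnd xi) HG) as [G' [g' [HG' [Hg' [E Hav]]]]].
    exists (g', trunc g' G'); split; [| simpl; split; [order HK | split]].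
    + apply move_intro with (g := g); try assumption.
      intros eta He; destruct (Hglue eta He) as [H1 H2]; split; [exact H1 |].
      intros alpha Ha; rewrite (E alpha Ha); auto.
    + intros alpha Ha; rewrite trunc_lt; [| order HK].
      rewrite E; [auto | order HK].
    + intros C HC EC; apply Hav; [exact HC |].
      intros alpha Ha; rewrite (EC alpha Ha); apply trunc_lt; exact Ha.
  - assert (Hr : is_run threaded h) by (intro; apply Hh).
    exists h; split; [exact Hr | split].
    (* [g0] serves here as an arbitrary stage index: every stage commits beyond the point [g0]. *)
    + intros alpha Ha; destruct (Hh g0) as [_ [H1 [H2 _]]].
      rewrite (limit_of_run_below threaded h Hr g0); [auto | order HK].
    + intro i; destruct (Hh i) as [_ [_ [_ H]]]; apply H; [apply limit_of_run_Coh; exact Hr |].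
      intros alpha Ha; apply limit_of_run_below; assumption.
Qed.

Lemma Triv_not_Baire : ~ has_Baire_prop (Coh ltN ltK) (basic_Coh ltN ltK) K (Triv ltN ltK).
Proof.
  intros [U [Nd [[HU Hopen] [Hnd Hsym]]]].
  (* A nonempty [U] contains a generic nontrivial sequence; an empty [U] misses a generic trivial
     one. *)
  destruct (classic (exists C, U C)) as [[C UC] | Hn].
  - destruct (Hopen C UC) as [b [[g [D [_ Hb]]] [bC HbU]]].
    destruct (generic_run false Nd C g Hnd (HU C UC)) as [h [Hh [E Hav]]].
    pose proof (limit_of_run_Coh false h Hh) as Hc.
    destruct (Hsym (limit_of_run false h)) as [i Hi]; [| exact (Hav i Hi)].
    right; split; [| exact (unthreaded_run_not_Triv h Hh)].
    apply HbU; [exact Hc |]; apply Hb; split; [exact Hc |].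
    intros alpha Ha; rewrite (E alpha Ha); apply (proj1 (Hb C) bC); exact Ha.
  - destruct kappa_inhabited as [k].
    destruct (generic_run true Nd L k Hnd ladder_Coh) as [h [Hh [_ Hav]]].
    destruct (Hsym (limit_of_run true h)) as [i Hi]; [| exact (Hav i Hi)].
    left; split; [exact (threaded_run_Triv h Hh) |]; intro H; apply Hn; eexists; exact H.
Qed.

(** * Parametrization by functions *)

(** A stage amounts to [delta] with a subset of its square, as entries below [delta] are subsets of
    [delta] and later ones are ladders. Both are coded by subsets of [N], so [2^nu = kappa]
    applies. *)
Lemma stage_coding : exists j : stage -> K, forall a a' : stage,
  Coh ltN ltK (snd a) -> (forall alpha, le ltK (fst a) alpha -> snd a alpha = L alpha) ->
  Coh ltN ltK (snd a') -> (forall alpha, le ltK (fst a') alpha -> snd a' alpha = L alpha) ->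
  j a = j a' -> a = a'.
Proof.
  destruct nu_nontrivial as [n0 [n1 Hne]], pairing as [p Hp].
  destruct (@kappa_coding (N + N * N) (fun i => match i with
    | inl n => p (n0, n) | inr nm => p (n1, p nm) end)) as [c Hc].
  { intros [n | nm] [n' | nm'] E; apply Hp in E; injection E; try congruence.
    intro E'; apply Hp in E'; congruence. }
  destruct (choice _ segment_injection) as [g Hg], Hpow as [b [_ Hb]].
  destruct (choice _ Hb) as [u Hu].
  pose (graph := fun (a : stage) (nm : N * N) => exists alpha xi,
    ltK alpha (fst a) /\ ltK xi (fst a) /\ (g (fst a) alpha, g (fst a) xi) = nm /\ snd a alpha xi).
  assert (Hgraph : forall a a', fst a = fst a' -> Coh ltN ltK (snd a) ->
    (forall nm, graph a nm -> graph a' nm) ->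
    forall alpha xi, ltK alpha (fst a) -> snd a alpha xi -> snd a' alpha xi).
  { intros a a' E [HC _] H alpha xi Ha Hx.
    pose proof (proj1 (HC alpha I) xi Hx) as Hxa.
    assert (Hxd : ltK xi (fst a)) by order HK.
    destruct (H (g (fst a) alpha, g (fst a) xi)) as [alpha' [xi' [H1 [H2 [H3 H4]]]]].
    - exists alpha, xi; auto.
    - rewrite <- E in *; injection H3 as E1 E2.
      apply Hg in E1, E2; try assumption; subst; exact H4. }
  exists (fun a => c (fun i => match i with inl n => u (fst a) n = true | inr nm => graph a nm end)).
  intros a a' HC Hn HC' Hn' E; apply Hc in E.
  assert (E1 : fst a = fst a').
  { rewrite <- (Hu (fst a)), <- (Hu (fst a')); f_equal; apply functional_extensionality; intro n.
    apply (f_equal (fun S => S (inl n))) in E; simpl in E.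
    destruct (u (fst a) n), (u (fst a') n); try reflexivity;
    [symmetry; rewrite <- E | rewrite E]; reflexivity. }
  assert (E2 : forall nm, graph a nm = graph a' nm).
  { intro nm; exact (f_equal (fun S => S (inr nm)) E). }
  apply injective_projections; [exact E1 |].
  apply functional_extensionality; intro alpha.
  destruct (le_or_lt HK (fst a) alpha) as [H | H].
  - rewrite Hn, Hn'; [reflexivity | rewrite <- E1; exact H | exact H].
  - apply functional_extensionality; intro xi; apply propositional_extensionality; split.
    + apply Hgraph; trivial; intro nm; rewrite E2; trivial.
    + apply Hgraph; trivial; [congruence | intro nm; rewrite E2; trivial | rewrite <- E1; exact H].
Qed.

(** There are at most [kappa] legal moves by [stage_coding], and at least that many because the
    amalgam may be cut at any point above a bound of the earlier ones. *)
Lemma move_bijection threaded xi h :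
  (forall eta, ltK eta xi -> move threaded eta h (h eta)) ->
  exists e : K -> stage, (forall k, move threaded xi h (e k)) /\
    (forall k k', e k = e k' -> k = k') /\ (forall a, move threaded xi h a -> exists k, e k = a).
Proof.
  intro Hh; destruct (run_bounded xi h) as [g Hg], stage_coding as [j Hj].
  destruct (unbounded_bijection (ltK g)) as [s [Hs [Hinj _]]].
  { intro x; destruct (kappa_above g x) as [y [H1 H2]]; exists y; split; [| left]; assumption. }
  apply (bijection_onto (move threaded xi h) j
           (fun k => (s k, trunc (s k) (glue threaded (below xi) h)))).
  - intros a a' M M'; apply Hj; apply M || apply M'.
  - intro k; apply move_intro with (g := g); [exact Hh | | | apply Hs].
    + apply glue_Coh; [unfold below; intros; order HK | exact Hh].
    + intros eta He; split; [exact (Hg eta He) | reflexivity].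
  - intros k k' E; apply Hinj; exact (f_equal fst E).
Qed.

(** [Phi x] makes at stage [xi] the legal move with index [x xi]. The last clause is what continuity
    needs. *)
Lemma run_parametrization threaded : exists Phi : (K -> K) -> K -> stage,
  (forall x, is_run threaded (Phi x)) /\
  (forall x x', Phi x = Phi x' -> x = x') /\
  (forall h, is_run threaded h -> exists x, Phi x = h) /\
  (forall x x' xi, (forall eta, le ltK eta xi -> x eta = x' eta) -> Phi x xi = Phi x' xi).
Proof.
  destruct kappa_inhabited as [k0]; pose (a0 := (k0, L) : stage).
  destruct (choice (fun (p : K * (K -> stage)) (e : K -> stage) =>
      (forall eta, ltK eta (fst p) -> move threaded eta (snd p) (snd p eta)) ->
      (forall k, move threaded (fst p) (snd p) (e k)) /\ (forall k k', e k = e k' -> k = k') /\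
      (forall a, move threaded (fst p) (snd p) a -> exists k, e k = a))) as [e Hbij].
  { intros [xi h]; simpl.
    destruct (classic (forall eta, ltK eta xi -> move threaded eta h (h eta))) as [H | H].
    - destruct (move_bijection threaded xi h H) as [e He]; exists e; intros _; exact He.
    - exists (fun _ => a0); intro; contradiction. }
  destruct (choice _ (fun x => transfinite_recursion HK a0 (fun xi h => e (xi, h) (x xi)))) as [Phi HPhi].
  (* [e] may depend on a whole history, so it is always fed the one cut off at [xi]. *)
  pose (cut := restrict (lt := ltK) a0).
  assert (Hcut : forall h xi, (forall eta, ltK eta xi -> move threaded eta h (h eta)) ->
            forall eta, ltK eta xi -> move threaded eta (cut xi h) (cut xi h eta)).
  { intros h xi H eta He; unfold cut; rewrite (restrict_lt a0 _ _ _ He).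
    apply move_local with (h := h); [| exact (H eta He)].
    intros zeta Hz; symmetry; apply restrict_lt; order HK. }
  assert (Hrun : forall x, is_run threaded (Phi x)).
  { intros x xi; induction xi as [xi IH] using (well_founded_ind (wo_wf HK)).
    apply move_local with (h := cut xi (Phi x)); [intros; apply restrict_lt; assumption |].
    rewrite HPhi; apply (Hbij (xi, cut xi (Phi x))); exact (Hcut _ _ IH). }
  exists Phi; split; [exact Hrun | split; [| split]].
  - intros x x' E; apply functional_extensionality; intro xi.
    pose proof (f_equal (fun h => h xi) E) as Exi; simpl in Exi; rewrite !HPhi, <- E in Exi.
    revert Exi; apply (Hbij (xi, cut xi (Phi x))); apply Hcut; intros; apply Hrun.
  - intros h Hh.
    destruct (choice (fun xi k => e (xi, cut xi h) k = h xi)) as [x Hx].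
    { intro xi; apply (Hbij (xi, cut xi h)); simpl; [apply Hcut; intros; apply Hh |].
      apply move_local with (h := h); [intros; symmetry; apply restrict_lt; assumption | apply Hh]. }
    exists x; apply functional_extensionality; intro xi.
    induction xi as [xi IH] using (well_founded_ind (wo_wf HK)).
    rewrite HPhi, <- Hx; do 2 f_equal; apply restrict_ext; exact IH.
  - intros x x' xi; induction xi as [xi IH] using (well_founded_ind (wo_wf HK)); intro E.
    rewrite !HPhi, (E xi (or_intror eq_refl)); do 2 f_equal; apply restrict_ext.
    intros eta Hlt; apply IH; [exact Hlt |]; intros zeta Hz; apply E; order HK.
Qed.

(* The points [fst (h xi)] are exactly the points of the thread that are not limits of the earlier ones,
   hence are recovered from the thread. *)
Lemma run_first_difference threaded h h' xi : is_run threaded h -> is_run threaded h' ->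
  limit_closure (range full h) = limit_closure (range full h') ->
  (forall eta, ltK eta xi -> h eta = h' eta) -> ~ ltK (fst (h xi)) (fst (h' xi)).
Proof.
  intros Hh Hh' Ecl E Hlt.
  assert (Hr : forall z, ltK z (fst (h' xi)) -> range full h' z -> range (below xi) h z).
  { intros z Hz Rz; rewrite (range_ext xi h h' E).
    apply (range_below threaded full h'); try assumption; try exact I; intros; [exact I | apply Hh']. }
  assert (Hc : limit_closure (range full h') (fst (h xi))).
  { rewrite <- Ecl; left; exists xi; split; [exact I | reflexivity]. }
  destruct Hc as [Hc | Hc].
  - destruct (Hr _ Hlt Hc) as [eta [He Eq]].
    pose proof (run_increasing_full threaded h Hh eta xi He); order HK.
  (* Here [fst (h xi)] would be a limit of the points before it, whereas a move lies strictly above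
     such limits. *)
  - apply (lt_irrefl HK (fst (h xi))), (move_limit_lt _ _ _ _ (Hh xi)).
    revert Hc; apply limit_point_mono; intros z Hz; apply Hr; order HK.
Qed.

(** Equal limits have the same thread, from which the first components are recovered; the second
    ones are then truncations of the common limit. *)
Lemma run_determined h h' : is_run true h -> is_run true h' ->
  limit_of_run true h = limit_of_run true h' -> h = h'.
Proof.
  intros Hh Hh' EC.
  pose proof (run_thread h Hh) as T; rewrite EC in T.
  pose proof (thread_unique _ _ _ T (run_thread h' Hh')) as Ecl.
  apply functional_extensionality; intro xi.
  induction xi as [xi IH] using (well_founded_ind (wo_wf HK)).
  assert (E1 : fst (h xi) = fst (h' xi)).
  { destruct (wo_total HK (fst (h xi)) (fst (h' xi))) as [H | [H | H]]; [| exact H |]; exfalso.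
    - exact (run_first_difference true h h' xi Hh Hh' Ecl IH H).
    - refine (run_first_difference true h' h xi Hh' Hh (eq_sym Ecl) _ H).
      intros eta He; symmetry; exact (IH eta He). }
  apply injective_projections; [exact E1 |].
  apply functional_extensionality; intro alpha.
  destruct (le_or_lt HK (fst (h xi)) alpha) as [H | H].
  - rewrite (move_ge _ _ _ _ (Hh xi) alpha H).
    rewrite (move_ge _ _ _ _ (Hh' xi) alpha); [reflexivity | order HK].
  - rewrite <- (limit_of_run_below true h Hh xi alpha H), EC.
    apply limit_of_run_below; [exact Hh' | order HK].
Qed.

(** The stages are the truncations of [C] at those points of its thread [D] that are not limits of
    points chosen before, taken in increasing order. *)
Lemma Triv_limit_of_run C : Triv ltN ltK C -> exists h, is_run true h /\ limit_of_run true h = C.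
Proof.
  intros [HC Ht]; apply trivial_iff_thread in Ht; [| exact HC].
  destruct Ht as [D [[Hu Hcl] HD]], kappa_inhabited as [k0].
  pose (cand := fun xi (h : K -> stage) x => D x /\ (forall eta, ltK eta xi -> ltK (fst (h eta)) x) /\
                  forall gamma, limit_point ltK (range (below xi) h) gamma -> ltK gamma x).
  destruct (transfinite_choice HK (k0, L) (fun xi h a => cand xi h (fst a) /\
      (forall x, cand xi h x -> le ltK (fst a) x) /\ snd a = trunc (fst a) C)) as [h Hh].
  - intros xi h h' a E H.
    assert (Ec : cand xi h = cand xi h'); [| rewrite <- Ec; exact H].
    apply functional_extensionality; intro x; apply propositional_extensionality; unfold cand.
    rewrite (range_ext xi h h' E).
    split; intros [H1 [H2 H3]]; (split; [exact H1 | split; [| exact H3]]); intros eta He;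
    [rewrite <- (E eta He) | rewrite (E eta He)]; auto.
  - intros xi h _; destruct (run_bounded xi h) as [g Hg].
    destruct (kappa_above g g) as [g' [Hg' _]], (Hu g') as [x0 [Dx0 Hx0]].
    destruct (least HK (cand xi h)) as [x [Hx Hm]].
    + exists x0; split; [exact Dx0 | split].
      * intros eta He; specialize (Hg eta He); order HK.
      * intros gamma Hl; destruct (le_or_lt HK gamma g) as [H | H]; [order HK |].
        destruct (limit_point_above _ _ _ Hl H) as [z [[eta [He <-]] [H1 H2]]].
        specialize (Hg eta He); order HK.
    + exists (x, trunc x C); simpl; auto.
  - assert (Hinc : forall eta xi, ltK eta xi -> ltK (fst (h eta)) (fst (h xi))).
    { intros eta xi H; exact (proj1 (proj2 (proj1 (Hh xi))) eta H). }
    assert (HRD : forall x, range full h x -> D x).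
    { intros x [eta [_ <-]]; exact (proj1 (proj1 (Hh eta))). }
    assert (Hcl' : forall x, D x <-> limit_closure (range full h) x).
    { intro x; split.
      - intro Dx.
        (* Take the first [xi] whose point is at least [x]. If that point is larger, [x] was no
           candidate at [xi], which can only be because [x] is a limit of the earlier points. *)
        destruct (least HK (fun xi => le ltK x (fst (h xi)))) as [xi [[Hx | Hx] Hm]].
        + exists x; apply (increasing_ge (fun xi => fst (h xi)) Hinc).
        + assert (Hlt : forall eta, ltK eta xi -> ltK (fst (h eta)) x).
          { intros eta He; destruct (le_or_lt HK x (fst (h eta))) as [H | H]; [| exact H].
            apply Hm in H; order HK. }
          assert (Hn : ~ cand xi h x) by (intro H; apply (proj1 (proj2 (Hh xi))) in H; order HK).
          apply NNPP; intro Hx'; apply Hn; split; [exact Dx | split; [exact Hlt |]].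
          intros gamma Hl; destruct (wo_total HK gamma x) as [H | [-> | H]]; [exact H | |].
          * destruct Hx'; right; revert Hl; apply limit_point_mono.
            intros z _ [eta [_ <-]]; exists eta; split; [exact I | reflexivity].
          * destruct (limit_point_above _ _ _ Hl H) as [z [[eta [He <-]] [H1 H2]]].
            specialize (Hlt eta He); order HK.
        + left; exists xi; split; [exact I | symmetry; exact Hx].
      - intros [Hx | [Hl Hx]]; [exact (HRD x Hx) | apply Hcl; [exact Hl |]].
        intros b Hb; destruct (Hx b Hb) as [z [Rz Hz]]; exists z; split; [exact (HRD z Rz) | exact Hz]. }
    assert (Hrun : is_run true h).
    { intro xi; destruct (Hh xi) as [[_ [Hx2 Hx3]] [_ Exi]]; split; rewrite ?Exi.
      - exact (trunc_Coh _ C HC).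
      - apply trunc_ge.
      - intros eta; apply Hinc.
      - intros eta He alpha Ha; destruct (Hh eta) as [_ [_ Eeta]]; specialize (Hinc eta xi He).
        rewrite Eeta, !trunc_lt; [reflexivity | exact Ha | order HK].
      - exact Hx3.
      - intros gamma Hl Hcof; rewrite trunc_lt; [| exact (Hx3 gamma Hl)].
        assert (Hr : forall z, ltK z gamma -> (range full h z <-> range (below xi) h z)).
        { intros z Hz; split; intros [eta [He <-]]; exists eta; (split; [| reflexivity]); [| exact I].
          specialize (Hx3 gamma Hl).
          apply (increasing_lt_inv (fun xi => fst (h xi)) Hinc); order HK. }
        rewrite <- (target_ext true _ _ gamma Hr).
        apply functional_extensionality; intro x; apply propositional_extensionality.
        rewrite (HD gamma); [| | exact Hcof].
        + rewrite (Hcl' x); reflexivity.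
        + revert Hl; apply limit_point_mono; intros z Hz Rz; apply HRD, Hr; assumption. }
    exists h; split; [exact Hrun |]; apply functional_extensionality; intro alpha.
    (* The point of a stage is at least its index, so stage [xi] decides the value at [alpha]. *)
    destruct (kappa_above alpha alpha) as [xi [Hxi _]].
    pose proof (increasing_ge (fun xi => fst (h xi)) Hinc xi) as Hge; simpl in Hge.
    rewrite (limit_of_run_below true h Hrun xi); [| order HK].
    destruct (Hh xi) as [_ [_ ->]]; apply trunc_lt; order HK.
Qed.

Lemma Triv_continuous_image :
  exists f : (K -> K) -> (K -> K -> Prop),
    continuous_between (fun _ => True) (basic_Baire ltK)
                       (Coh ltN ltK) (basic_Coh ltN ltK) f /\
    (forall x y, f x = f y -> x = y) /\
    (forall C, Triv ltN ltK C <-> exists x, f x = C).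
Proof.
  destruct (run_parametrization true) as [Phi [Hrun [Hinj [Hsurj Hloc]]]].
  exists (fun x => limit_of_run true (Phi x)); split; [split | split].
  - intros x _; apply limit_of_run_Coh, Hrun.
  - intros U [HU Hopen]; split; [trivial |].
    intros x [_ Ux]; destruct (Hopen _ Ux) as [b [[gamma [D [_ Hb]]] [bx HbU]]].
    (* [c] lies above [gamma] so that agreement below [c] includes the coordinate [gamma]; stage
       [gamma] then settles all values below [gamma]. *)
    destruct (kappa_above gamma gamma) as [c [Hc _]].
    exists (fun y => forall alpha, ltK alpha c -> y alpha = x alpha).
    split; [exists c, x; reflexivity | split; [reflexivity |]].
    intros y _ Exy; split; [exact I |].
    pose proof (limit_of_run_Coh true _ (Hrun y)) as HC.
    apply HbU; [exact HC |]; apply Hb; split; [exact HC |].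
    intros alpha Ha; rewrite <- (proj2 (proj1 (Hb _) bx) alpha Ha).
    assert (E : Phi y gamma = Phi x gamma).
    { apply Hloc; intros eta He; apply Exy; order HK. }
    assert (Hlt : ltK alpha (fst (Phi x gamma))).
    { pose proof (increasing_ge (fun xi => fst (Phi x xi)) (run_increasing_full true _ (Hrun x)) gamma).
      simpl in *; order HK. }
    rewrite (limit_of_run_below true _ (Hrun x) gamma alpha Hlt).
    rewrite (limit_of_run_below true _ (Hrun y) gamma alpha); rewrite E; trivial.
  - intros x y E; apply Hinj, run_determined; auto.
  - intro C; split.
    + intro HC; destruct (Triv_limit_of_run C HC) as [h [Hh <-]], (Hsurj h Hh) as [x <-].
      exists x; reflexivity.
    + intros [x <-]; apply threaded_run_Triv, Hrun.
Qed.
End Cardinals.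

Theorem theorem3p4 (N : Type) (ltN : N -> N -> Prop) (K : Type) (ltK : K -> K -> Prop)
  (Hnu : infinite_cardinal ltN) (Hreg : regular ltN)
  (Hkappa : is_successor_cardinal_of ltK N)
  (Hpow : bijects (N -> bool) K) :
  (exists f : (K -> K) -> (K -> K -> Prop),
      continuous_between (fun _ => True) (basic_Baire ltK)
                         (Coh ltN ltK) (basic_Coh ltN ltK) f /\
      (forall x y, f x = f y -> x = y) /\
      (forall C, Triv ltN ltK C <-> exists x, f x = C))
  /\ ~ has_Baire_prop (Coh ltN ltK) (basic_Coh ltN ltK) K (Triv ltN ltK).
Proof.
  destruct (ladder_system_exists Hnu Hreg Hkappa) as [L HL]; split.
  - exact (Triv_continuous_image Hnu Hreg Hkappa Hpow L HL).
  - exact (Triv_not_Baire Hnu Hreg Hkappa Hpow L HL).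
Qed.
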